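(* Let $\Lambda$ be an arbitrary ring. Suppose that the injective torsion on right $\Lambda$-modules splits off as a functor, i.e., the exact sequence $0\to\mathfrak{s}\to\mathbf{1}\to\mathfrak{s}^{-1}\to0$ of endofunctors of the category of right $\Lambda$-modules splits. Then $\mathfrak{s}=0$, i.e., $\Lambda$ is left absolutely pure.
   Context: Let $\iota:\Lambda\to I$ be the injective envelope of $\Lambda$ viewed as a left $\Lambda$-module. For a right $\Lambda$-module $A$, the injective torsion is $\mathfrak{s}(A):=\ker\big(1\otimes\iota: A\otimes_\Lambda\Lambda\to A\otimes_\Lambda I\big)$, identified with a submodule of $A$ via $A\otimes_\Lambda\Lambda\cong A$. $\mathbf{1}$ denotes the identity functor on right $\Lambda$-modules and $\mathfrak{s}^{-1}:=\mathbf{1}/\mathfrak{s}$, i.e. $\mathfrak{s}^{-1}(A)=A/\mathfrak{s}(A)$. The sequence splits if it is split by natural transformations. $\Lambda$ is left absolutely pure if ${}_\Lambda\Lambda$ is an absolutely pure module, i.e., every monomorphism from ${}_\Lambda\Lambda$ into a left $\Lambda$-module is pure. *)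

(* Defs.v *)
From HB Require Import structures.
From mathcomp Require Import all_boot all_algebra.
From mathcomp Require Import generic_quotient ring_quotient boolp freeg.

Set Implicit Arguments.
Unset Strict Implicit.
Unset Printing Implicit Defensive.

Import GRing.Theory.

Local Open Scope ring_scope.
Local Open Scope quotient_scope.

(* Left R-modules are [lmodType R].  Right R-modules are left modules over the
   converse ring R^c, the right action of r on a being [(r : R^c) *: a].
   [pzRingType] is the type of all associative unital rings, the zero ring
   included. *)
Notation rmodType R := (lmodType R^c).

Local Notation "{ 'quot' I }" := (Quotient.quot I) : type_scope.

Section QuotientGroup.
Variables (V : zmodType) (S : zmodClosed V).

Lemma quot_eq0 (x : V) : (\pi_({quot S}) x == 0) = (x \in S).
Proof. by rewrite -[X in X \in S]subr0 Quotient.idealrBE raddf0. Qed.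

Lemma quot_repr (x : V) : repr (\pi_({quot S}) x) - x \in S.
Proof. by rewrite -quot_eq0 raddfB /= reprK subrr. Qed.

Section Lift.
Variables (C : zmodType) (f : {additive V -> C}).
Hypothesis fS : {in S, forall x, f x = 0}.

Definition quot_lift (f0 : {in S, forall x, f x = 0}) (t : {quot S}) : C :=
  f (repr t).

Lemma quot_liftE x : quot_lift fS (\pi x) = f x.
Proof. by apply/eqP; rewrite -subr_eq0 -raddfB /= fS // quot_repr. Qed.

Fact quot_lift_zmod_morphism : zmod_morphism (quot_lift fS).
Proof. by elim/quotW=> x; elim/quotW=> y; rewrite -raddfB !quot_liftE raddfB. Qed.

HB.instance Definition _ :=
  GRing.isZmodMorphism.Build {quot S} C (quot_lift fS) quot_lift_zmod_morphism.

End Lift.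
End QuotientGroup.

Section QuotientModule.
Variables (R : pzRingType) (V : lmodType R) (S : submodClosed V).

Definition submod_pred : {pred V} := S.

HB.instance Definition _ :=
  GRing.isSubmodClosed.Build R V submod_pred (GRing.subsemimodClosedP S).

Definition quotmod := {quot submod_pred}.

HB.instance Definition _ := GRing.Zmodule.on quotmod.

Definition quotmod_pi (x : V) : quotmod := \pi_({quot submod_pred}) x.

Definition quotmod_scale (r : R) (q : quotmod) : quotmod :=
  quotmod_pi (r *: repr (q : {quot submod_pred})).

Fact quotmod_scaleE r x : quotmod_scale r (quotmod_pi x) = quotmod_pi (r *: x).
Proof.
apply/eqP; rewrite -subr_eq0 /quotmod_scale /quotmod_pi -raddfB /= quot_eq0.
by rewrite -scalerBr; apply: (rpredZ r); exact: quot_repr.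
Qed.

Fact quotmod_pi_zmod_morphism : zmod_morphism quotmod_pi.
Proof. by move=> x y; rewrite /quotmod_pi raddfB. Qed.

HB.instance Definition _ :=
  GRing.isZmodMorphism.Build V quotmod quotmod_pi quotmod_pi_zmod_morphism.

Lemma quotmod_surj (q : quotmod) : exists x, quotmod_pi x = q.
Proof. by exists (repr (q : {quot submod_pred})); rewrite /quotmod_pi reprK. Qed.

Lemma quotmod_eq0 x : (quotmod_pi x == 0) = (x \in S).
Proof. exact: quot_eq0. Qed.

Fact quotmod_scalerA a b v :
  quotmod_scale a (quotmod_scale b v) = quotmod_scale (a * b) v.
Proof. by have [x <-] := quotmod_surj v; rewrite !quotmod_scaleE scalerA. Qed.

Fact quotmod_scale1r : left_id 1 quotmod_scale.
Proof. by move=> v; have [x <-] := quotmod_surj v; rewrite quotmod_scaleE scale1r. Qed.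

Fact quotmod_scalerDr : right_distributive quotmod_scale +%R.
Proof.
move=> a u v; have [x <-] := quotmod_surj u; have [y <-] := quotmod_surj v.
by rewrite -raddfD !quotmod_scaleE scalerDr raddfD.
Qed.

Fact quotmod_scalerDl v : {morph quotmod_scale^~ v : a b / a + b}.
Proof.
move=> a b /=; have [x <-] := quotmod_surj v.
by rewrite !quotmod_scaleE scalerDl raddfD.
Qed.

HB.instance Definition _ := GRing.Zmodule_isLmodule.Build R quotmod
  quotmod_scalerA quotmod_scale1r quotmod_scalerDr quotmod_scalerDl.

Fact quotmod_pi_scalable : scalable quotmod_pi.
Proof. by move=> a x; rewrite -quotmod_scaleE. Qed.

HB.instance Definition _ :=
  GRing.isScalable.Build R V quotmod *:%R quotmod_pi quotmod_pi_scalable.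

End QuotientModule.

Section QuotientModuleLift.
Variables (R : pzRingType) (V W : lmodType R) (S : submodClosed V).
Variable f : {linear V -> W}.
Hypothesis fS : {in S, forall x, f x = 0}.

Definition quotmod_lift (f0 : {in S, forall x, f x = 0}) (q : quotmod S) : W :=
  @quot_lift V (submod_pred S) W f f0 q.

Lemma quotmod_liftE x : quotmod_lift fS (quotmod_pi S x) = f x.
Proof. exact: quot_liftE. Qed.

Fact quotmod_lift_linear : linear (quotmod_lift fS).
Proof.
move=> a u v; have [x <-] := quotmod_surj u; have [y <-] := quotmod_surj v.
by rewrite -linearP !quotmod_liftE linearP.
Qed.

HB.instance Definition _ := GRing.isLinear.Build R (quotmod S) W *:%R
  (quotmod_lift fS) quotmod_lift_linear.

End QuotientModuleLift.
Arguments quotmod_lift {R V W S f} _ q.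

Section TensorProduct.
Variables (R : pzRingType) (A : rmodType R) (B : lmodType R).

Local Notation F := {freeg (A * B) / int}.

Inductive tensor_relator : F -> Prop :=
| TensorDl a a' b :
    tensor_relator (<<(a + a', b)>> - <<(a, b)>> - <<(a', b)>>)
| TensorDr a b b' :
    tensor_relator (<<(a, b + b')>> - <<(a, b)>> - <<(a, b')>>)
| TensorM a (r : R) b :
    tensor_relator (<<((r : R^c) *: a, b)>> - <<(a, r *: b)>>).

(* The subgroup of F generated by the relators. *)
Definition tensor_relation : {pred F} := fun x =>
  `[< forall S : zmodClosed F,
        (forall y, tensor_relator y -> y \in S) -> x \in S >].

Fact tensor_relation_zmod_closed : zmod_closed tensor_relation.
Proof.
split=> [|x y /asboolP Hx /asboolP Hy]; apply/asboolP => S HS.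
  exact: rpred0.
by apply: rpredB; [exact: Hx | exact: Hy].
Qed.

HB.instance Definition _ :=
  GRing.isZmodClosed.Build F tensor_relation tensor_relation_zmod_closed.

Lemma mem_tensor_relation x : tensor_relator x -> x \in tensor_relation.
Proof. by move=> xP; apply/asboolP => S; apply. Qed.

Definition tensor : zmodType := {quot tensor_relation}.

Definition tens (a : A) (b : B) : tensor :=
  \pi_({quot tensor_relation}) <<(a, b)>>.

Lemma tensDl a a' b : tens (a + a') b = tens a b + tens a' b.
Proof.
apply/eqP; rewrite -subr_eq0 opprD addrA /tens -!raddfB /= quot_eq0.
exact/mem_tensor_relation/TensorDl.
Qed.

Lemma tensDr a b b' : tens a (b + b') = tens a b + tens a b'.
Proof.
apply/eqP; rewrite -subr_eq0 opprD addrA /tens -!raddfB /= quot_eq0.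
exact/mem_tensor_relation/TensorDr.
Qed.

Lemma tensM a (r : R) b : tens ((r : R^c) *: a) b = tens a (r *: b).
Proof.
apply/eqP; rewrite -subr_eq0 /tens -!raddfB /= quot_eq0.
exact/mem_tensor_relation/TensorM.
Qed.

Fact tens_zmod_morphism a : zmod_morphism (tens a).
Proof. by move=> b b'; rewrite -[in RHS](subrK b' b) [in RHS]tensDr addrK. Qed.

HB.instance Definition _ a :=
  GRing.isZmodMorphism.Build B tensor (tens a) (@tens_zmod_morphism a).

Lemma tensBl a a' b : tens (a - a') b = tens a b - tens a' b.
Proof. by rewrite -[in RHS](subrK a' a) [in RHS]tensDl addrK. Qed.

Lemma tensor_ind (P : tensor -> Prop) :
    (forall a b, P (tens a b)) -> (forall x y, P x -> P y -> P (x - y)) ->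
  forall x, P x.
Proof.
move=> Ptens PB; elim/quotW => x.
have P0 : P 0 by rewrite -(subrr (tens 0 0)); apply: PB.
have PN y : P y -> P (- y) by rewrite -[- y]add0r; apply: PB.
have PD y z : P y -> P z -> P (y + z) by move=> ? ?; rewrite -[z]opprK; apply/PB/PN.
rewrite -(freeg_sumE x) raddf_sum /=; elim/big_rec: _ => // -[a b] y _ Py.
apply: (PD) => //; set k := coeff _ _.
have -> : <<k *g (a, b)>> = <<(a, b)>> *~ k by rewrite freegU_mulz intz.
have PMn n : P (tens a b *+ n) by elim: n => // n IH; rewrite mulrS; apply: (PD).
by rewrite raddfMz; case: k => n; rewrite ?NegzE ?mulrNz; [|apply: PN]; apply: PMn.
Qed.

Definition balanced (C : zmodType) (f : A -> B -> C) :=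
  [/\ forall a a' b, f (a + a') b = f a b + f a' b,
      forall a b b', f a (b + b') = f a b + f a b'
    & forall a (r : R) b, f ((r : R^c) *: a) b = f a (r *: b)].

Section Lift.
Variables (C : zmodType) (f : A -> B -> C).
Hypothesis fP : balanced f.

Definition freeg_lift (x : F) : C := fglift (fun p => f p.1 p.2 : zmodule C) x.

Fact freeg_lift_zmod_morphism : zmod_morphism freeg_lift.
Proof. exact: (@lift_is_additive int (A * B)%type (zmodule C)). Qed.

HB.instance Definition _ :=
  GRing.isZmodMorphism.Build F C freeg_lift freeg_lift_zmod_morphism.

Lemma freeg_liftU a b : freeg_lift <<(a, b)>> = f a b.
Proof. by rewrite /freeg_lift liftU scale1r. Qed.

Definition freeg_lift_ker : {pred F} := fun x => freeg_lift x == 0.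

Fact freeg_lift_ker_zmod_closed : zmod_closed freeg_lift_ker.
Proof.
split=> [|x y]; rewrite !unfold_in ?raddf0 // => /eqP x0 /eqP y0.
by rewrite raddfB /= x0 y0 subrr.
Qed.

HB.instance Definition _ :=
  GRing.isZmodClosed.Build F freeg_lift_ker freeg_lift_ker_zmod_closed.

Fact freeg_lift0 (_ : balanced f) : {in tensor_relation, forall x, freeg_lift x = 0}.
Proof.
move=> x /asboolP /(_ freeg_lift_ker) xP; apply/eqP; apply: xP => y.
have [fDl fDr fM] := fP.
case=> *; rewrite unfold_in !raddfB /= !freeg_liftU.
- by rewrite fDl -addrA -opprD subrr.
- by rewrite fDr -addrA -opprD subrr.
- by rewrite fM subrr.
Qed.

Definition tensor_lift : {additive tensor -> C} := quot_lift (freeg_lift0 fP).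

Lemma tensor_liftE a b : tensor_lift (tens a b) = f a b.
Proof. by apply: etrans (quot_liftE _ _) _; exact: freeg_liftU. Qed.

End Lift.

End TensorProduct.

Section TensorMap.
Variables (R : pzRingType) (A : rmodType R) (B B' : lmodType R).
Variable f : {linear B -> B'}.

Fact tensor_map_balanced : balanced (fun (a : A) (b : B) => tens a (f b)).
Proof.
split=> *; first exact: tensDl.
  by rewrite linearD tensDr.
by rewrite linearZ tensM.
Qed.

(* The map 1 (x) f : A (x) B -> A (x) B'. *)
Definition tensor_map : {additive tensor A B -> tensor A B'} :=
  tensor_lift tensor_map_balanced.

Lemma tensor_mapE a b : tensor_map (tens a b) = tens a (f b).
Proof. exact: tensor_liftE. Qed.

End TensorMap.
Arguments tensor_map {R} A {B B'} f.

Section TensorUnit.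
Variables (R : pzRingType) (A : rmodType R).

(* The identification A ~ A (x) R. *)
Definition tensor_unit (a : A) : tensor A R^o := tens a (1 : R^o).

Fact tensor_unit_zmod_morphism : zmod_morphism tensor_unit.
Proof. by move=> a b; rewrite /tensor_unit tensBl. Qed.

HB.instance Definition _ := GRing.isZmodMorphism.Build A (tensor A R^o)
  tensor_unit tensor_unit_zmod_morphism.

Fact ract_balanced : balanced (fun (a : A) (r : R^o) => (r : R^c) *: a).
Proof.
split=> *; first exact: scalerDr.
  exact: scalerDl.
exact: scalerA.
Qed.

Lemma tensor_unit_bij : bijective tensor_unit.
Proof.
exists (tensor_lift ract_balanced) => [a|x].
  by rewrite tensor_liftE scale1r.
elim/tensor_ind: x => [a r|x y xP yP]; last by rewrite !raddfB /= xP yP.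
by rewrite tensor_liftE /tensor_unit tensM /= /GRing.scale /= mulr1.
Qed.

End TensorUnit.

Section Modules.
Variable R : pzRingType.

Definition injective_module (I : lmodType R) :=
  forall (B C : lmodType R) (j : {linear B -> C}) (g : {linear B -> I}),
    injective j -> exists h : {linear C -> I}, forall x, h (j x) = g x.

(* Every nonzero submodule of the codomain meets the image nontrivially. *)
Definition essential (M N : lmodType R) (f : {linear M -> N}) :=
  forall S : submodClosed N, (exists2 y, y \in S & y != 0) ->
    exists2 x, f x \in S & f x != 0.

Record injective_envelope (M : lmodType R) := InjectiveEnvelope {
  env_mod : lmodType R;
  env_map : {linear M -> env_mod};
  env_injective : injective_module env_mod;
  env_mono : injective env_map;
  env_essential : essential env_map
}.

Definition pure_mono (M N : lmodType R) (f : {linear M -> N}) :=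
  injective f /\ forall A : rmodType R, injective (tensor_map A f).

Definition absolutely_pure (M : lmodType R) :=
  forall (N : lmodType R) (f : {linear M -> N}), injective f -> pure_mono f.

End Modules.

Arguments env_injective {R M} i {B C} j g _.
Arguments env_mono {R M} i.

Definition left_absolutely_pure (R : pzRingType) :=
  absolutely_pure (R^o : lmodType R).

Record endofunctor (S : pzRingType) := Endofunctor {
  fobj :> lmodType S -> lmodType S;
  fmap : forall A B : lmodType S, {linear A -> B} -> {linear fobj A -> fobj B};
  fmap_id : forall (A : lmodType S) (x : fobj A),
    fmap (idfun : {linear A -> A}) x = x;
  fmap_comp : forall (A B C : lmodType S)
      (g : {linear B -> C}) (f : {linear A -> B}) x,
    fmap (g \o f : {linear A -> C}) x = fmap g (fmap f x)
}.
Arguments fmap {S} F {A B} f : rename.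

Record nat_trans (S : pzRingType) (F G : endofunctor S) := NatTrans {
  ncomp :> forall A : lmodType S, {linear F A -> G A};
  ncomp_natural : forall (A B : lmodType S) (f : {linear A -> B}) x,
    ncomp B (fmap F f x) = fmap G f (ncomp A x)
}.

Section FunctorSequences.
Variables (S : pzRingType) (F G H : endofunctor S).
Variables (i : nat_trans F G) (p : nat_trans G H).

Definition short_exact := forall A : lmodType S,
  [/\ injective (i A),
      forall y, p A y = 0 <-> exists x, i A x = y
    & forall z, exists y, p A y = z].

Definition splits := exists (r : nat_trans G F) (s : nat_trans H G),
  forall A : lmodType S,
  [/\ forall x, r A (i A x) = x,
      forall z, p A (s A z) = z
    & forall y, i A (r A y) + s A (p A y) = y].

(* For an exact sequence, either half of the splitting data suffices. *)
Lemma split_of_section : short_exact ->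
  (exists s : nat_trans H G, forall (A : lmodType S) z, p A (s A z) = z) ->
  splits.
Proof.
move=> ex [s sK].
have rP (A : lmodType S) y : {x | i A x = y - s A (p A y)}.
  apply: cid; have [_ E _] := ex A; apply/E.
  by rewrite raddfB /= sK subrr.
pose r A y := sval (rP A y).
have rE A y : i A (r A y) = y - s A (p A y) := svalP (rP A y).
have iI A : injective (i A) by have [] := ex A.
have r_linear A : linear (r A).
  move=> a x y; apply: iI; rewrite linearP !rE !linearP.
  by rewrite /= scalerBr scalerN addrACA.
pose rL A : {linear G A -> F A} :=
  HB.pack (r A) (GRing.isLinear.Build S (G A) (F A) *:%R _ (r_linear A)).
have rN (A B : lmodType S) (f : {linear A -> B}) x :
    rL B (fmap G f x) = fmap F f (rL A x).
  by apply: iI; rewrite ncomp_natural /= !rE raddfB /= !ncomp_natural.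
exists (NatTrans rN), s => A; split=> // [x|y]; last by rewrite /= rE subrK.
apply: iI; rewrite /= rE; have [_ E _] := ex A.
have -> : p A (i A x) = 0 by apply/E; exists x.
by rewrite raddf0 subr0.
Qed.

Lemma split_of_retraction : short_exact ->
  (exists r : nat_trans G F, forall (A : lmodType S) x, r A (i A x) = x) ->
  splits.
Proof.
move=> ex [r rK].
have pE (A : lmodType S) y y' : p A y = p A y' ->
    y - i A (r A y) = y' - i A (r A y').
  move=> e; have [_ E _] := ex A.
  have [x xE] : exists x, i A x = y - y' by apply/E; rewrite raddfB /= e subrr.
  rewrite -[y](subrK y') -xE !raddfD /= rK.
  by rewrite addrACA subrr add0r.
have sP (A : lmodType S) z : {y | p A y = z}.
  by apply: cid; have [_ _] := ex A; apply.
pose s A z := sval (sP A z) - i A (r A (sval (sP A z))).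
have sE A y : s A (p A y) = y - i A (r A y) by apply/pE/(svalP (sP A _)).
have pS A z : exists y, p A y = z by have [y] := sP A z; exists y.
have pi0 A x : p A (i A x) = 0 by have [_ E _] := ex A; apply/E; exists x.
have s_linear A : linear (s A).
  move=> a u v; have [x <-] := pS A u; have [y <-] := pS A v.
  by rewrite -linearP !sE !linearP /= scalerBr scalerN addrACA.
pose sL A : {linear H A -> G A} :=
  HB.pack (s A) (GRing.isLinear.Build S (H A) (G A) *:%R _ (s_linear A)).
have sN (A B : lmodType S) (f : {linear A -> B}) z :
    sL B (fmap H f z) = fmap G f (sL A z).
  have [y <-] := pS A z.
  by rewrite -ncomp_natural /= !sE raddfB /= !ncomp_natural.
exists r, (NatTrans sN) => A; split=> // [z|y] /=; last by rewrite sE subrKC.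
by have [y <-] := pS A z; rewrite sE raddfB /= pi0 subr0.
Qed.

End FunctorSequences.

Fact id_functor_id (S : pzRingType) (A : lmodType S) (x : A) :
  (idfun : {linear A -> A}) x = x.
Proof. by []. Qed.

Fact id_functor_comp (S : pzRingType) (A B C : lmodType S)
    (g : {linear B -> C}) (f : {linear A -> B}) x :
  (g \o f : {linear A -> C}) x = g (f x).
Proof. by []. Qed.

Definition id_functor (S : pzRingType) : endofunctor S :=
  @Endofunctor S (fun A => A) (fun A B f => f)
    (@id_functor_id S) (@id_functor_comp S).

Section InjectiveTorsion.
Variables (R : pzRingType) (E : injective_envelope (R^o : lmodType R)).

Section Object.
Variable A : rmodType R.

(* The kernel of 1 (x) iota : A (x) R -> A (x) I, pulled back to A. *)
Definition torsion_pred : {pred A} := fun a =>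
  tensor_map A (env_map E) (tensor_unit a) == 0.

Lemma torsionE a : (a \in torsion_pred) = (tens a (env_map E 1) == 0).
Proof. by rewrite unfold_in tensor_mapE. Qed.

Fact torsion_submod_closed : GRing.subsemimod_closed torsion_pred.
Proof.
apply: GRing.submod_closed_semi; split=> [|r a b].
  by rewrite unfold_in !raddf0.
rewrite !torsionE => /eqP a0 /eqP b0; rewrite tensDl b0 addr0 tensM.
have rmul_linear : linear (fun x : R^o => x * r : R^o).
  by move=> c x y; rewrite mulrDl -[in LHS]mulrA.
pose rmul : {linear R^o -> R^o} :=
  HB.pack (fun x : R^o => x * r : R^o)
    (GRing.isLinear.Build R R^o R^o *:%R _ rmul_linear).
have [h hE] := env_injective E (env_map E)
  (env_map E \o rmul : {linear R^o -> env_mod E}) (env_mono E).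
have -> : (r : R) *: env_map E 1 = h (env_map E 1).
  by rewrite hE -linearZ /= mul1r [_ *: _]mulr1.
by rewrite -tensor_mapE a0 raddf0.
Qed.

HB.instance Definition _ :=
  GRing.isSubmodClosed.Build R^c A torsion_pred torsion_submod_closed.

Record torsion := Torsion { torsion_val : A; _ : torsion_val \in torsion_pred }.

HB.instance Definition _ := [isSub for torsion_val].
HB.instance Definition _ := [Choice of torsion by <:].
HB.instance Definition _ := [SubChoice_isSubLmodule of torsion by <:].

Definition torsion_quot := quotmod torsion_pred.

HB.instance Definition _ := GRing.Lmodule.on torsion_quot.

End Object.
Arguments torsion_pred : clear implicits.

Section Map.
Variables (A B : rmodType R) (f : {linear A -> B}).

Fact torsion_stable a : a \in torsion_pred A -> f a \in torsion_pred B.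
Proof.
rewrite !torsionE => /eqP a0.
have bf : balanced (fun (x : A) (y : env_mod E) => tens (f x) y).
  by split=> *; rewrite ?linearD ?tensDl ?tensDr // linearZ tensM.
by rewrite -(tensor_liftE bf) a0 raddf0.
Qed.

Definition torsion_map (x : torsion A) : torsion B :=
  Torsion (torsion_stable (valP x)).

Fact torsion_map_linear : linear torsion_map.
Proof. by move=> r x y; apply: val_inj; rewrite /= linearP. Qed.

HB.instance Definition _ := GRing.isLinear.Build R^c (torsion A) (torsion B)
  *:%R torsion_map torsion_map_linear.

Fact torsion_quot_map0 :
  {in torsion_pred A, forall a, (quotmod_pi (torsion_pred B) \o f) a = 0}.
Proof. by move=> a /torsion_stable fa; apply/eqP; rewrite quotmod_eq0. Qed.

Definition torsion_quot_map : {linear torsion_quot A -> torsion_quot B} :=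
  quotmod_lift torsion_quot_map0.

Lemma torsion_quot_mapE a : torsion_quot_map (quotmod_pi (torsion_pred A) a) =
  quotmod_pi (torsion_pred B) (f a).
Proof. exact: quotmod_liftE. Qed.

End Map.

Fact torsion_map_id (A : rmodType R) (x : torsion A) :
  torsion_map (idfun : {linear A -> A}) x = x.
Proof. exact: val_inj. Qed.

Fact torsion_map_comp (A B C : rmodType R)
    (g : {linear B -> C}) (f : {linear A -> B}) (x : torsion A) :
  torsion_map (g \o f : {linear A -> C}) x = torsion_map g (torsion_map f x).
Proof. exact: val_inj. Qed.

Definition torsion_functor : endofunctor R^c :=
  @Endofunctor R^c (fun A => torsion A) (fun A B f => torsion_map f)
    torsion_map_id torsion_map_comp.

Fact torsion_quot_map_id (A : rmodType R) (x : torsion_quot A) :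
  torsion_quot_map (idfun : {linear A -> A}) x = x.
Proof. by have [a <-] := quotmod_surj x; rewrite torsion_quot_mapE. Qed.

Fact torsion_quot_map_comp (A B C : rmodType R)
    (g : {linear B -> C}) (f : {linear A -> B}) (x : torsion_quot A) :
  torsion_quot_map (g \o f : {linear A -> C}) x =
  torsion_quot_map g (torsion_quot_map f x).
Proof. by have [a <-] := quotmod_surj x; rewrite !torsion_quot_mapE. Qed.

Definition torsion_quot_functor : endofunctor R^c :=
  @Endofunctor R^c (fun A => torsion_quot A) (fun A B f => torsion_quot_map f)
    torsion_quot_map_id torsion_quot_map_comp.

Fact torsion_incl_natural (A B : rmodType R) (f : {linear A -> B})
  (x : torsion A) : val (torsion_map f x) = f (val x).
Proof. by []. Qed.

Definition torsion_incl : nat_trans torsion_functor (id_functor R^c) :=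
  @NatTrans _ torsion_functor (id_functor R^c)
    (fun A => (val : torsion A -> A)) torsion_incl_natural.

Fact torsion_proj_natural (A B : rmodType R) (f : {linear A -> B}) (x : A) :
  quotmod_pi (torsion_pred B) (f x) =
  torsion_quot_map f (quotmod_pi (torsion_pred A) x).
Proof. by rewrite torsion_quot_mapE. Qed.

Definition torsion_proj : nat_trans (id_functor R^c) torsion_quot_functor :=
  @NatTrans _ (id_functor R^c) torsion_quot_functor
    (fun A => quotmod_pi (torsion_pred A)) torsion_proj_natural.

Lemma torsion_exact : short_exact torsion_incl torsion_proj.
Proof.
move=> A; split=> [|y|z]; first exact: val_inj.
  split=> [/eqP|[x <-]]; last by apply/eqP; rewrite quotmod_eq0; apply: valP.
  by rewrite quotmod_eq0 => yP; exists (Torsion yP).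
exact: quotmod_surj.
Qed.

End InjectiveTorsion.
Arguments torsion_pred {R} E A _.

(* Main.v *)
(* A module element [x : A] is the image of 1 under a map from the regular right
   module.  By naturality a retraction [r : 1 -> s] sends [x] to the image of
   [r 1], which lies in s(R) = ker iota = 0; hence r = 0, and s = 0 as r is onto.
   Any embedding of the regular left module into N is then pure, because iota
   factors through it. *)

Require Import Defs.
From HB Require Import structures.
From mathcomp Require Import all_boot all_algebra.
Import GRing.Theory.
Local Open Scope ring_scope.

(** The action map R ⊗ I → I, a ⊗ y ↦ a y, sends a ⊗ ι(1) to ι(a), so a torsion element [a] lies in
    the kernel of the injective ι. *)
Lemma regular_torsion_eq0 (R : pzRingType)
    (E : injective_envelope (R^o : lmodType R))
    (x : torsion E ((R^c)^o : lmodType R^c)) : x = 0.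
Proof.
case: x => a aP; apply: val_inj => /=.
have act_balanced : @balanced R ((R^c)^o : lmodType R^c) (env_mod E) (env_mod E)
    (fun a y => (a : R) *: y).
  split=> [? ? ?|? ? ?|b s y]; [exact: scalerDl | exact: scalerDr |].
  (* The product of [s] and [b] in [R^c] is b s in [R], so the goal is (b s) y = b (s y). *)
  by rewrite scalerA.
move: aP; rewrite torsionE => /eqP /(congr1 (tensor_lift act_balanced)).
rewrite raddf0 tensor_liftE -linearZ /= [_ *: _]mulr1 => a0.
by apply: (env_mono E); rewrite a0 raddf0.
Qed.

Lemma torsion_eq0_of_retraction (R : pzRingType)
    (E : injective_envelope (R^o : lmodType R))
    (r : nat_trans (id_functor R^c) (torsion_functor E)) :
    (forall A x, r A (torsion_incl E A x) = x) ->
  forall (A : lmodType R^c) (x : torsion E A), x = 0.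
Proof.
move=> rK A x.
have act_linear : linear (fun s : (R^c)^o => s *: val x).
  by move=> c s t; rewrite scalerDl scalerA.
pose act : {linear (R^c)^o -> A} := HB.pack (fun s : (R^c)^o => s *: val x)
  (GRing.isLinear.Build R^c (R^c)^o A *:%R _ act_linear).
have act1 : act 1 = torsion_incl E A x by rewrite /= scale1r.
(* Up to conversion [act] is its own image under [id_functor], so naturality of [r] applies. *)
rewrite -[x]rK -act1 [LHS](ncomp_natural r act).
by rewrite [r _ _]regular_torsion_eq0 raddf0.
Qed.

Lemma left_absolutely_pure_of_torsion_eq0 (R : pzRingType)
    (E : injective_envelope (R^o : lmodType R)) :
    (forall (A : lmodType R^c) (x : torsion E A), x = 0) ->
  left_absolutely_pure R.
Proof.
move=> s0 N f f_inj; split=> // A.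
have [h hf] := env_injective E f (env_map E) f_inj.
(* Every tensor in A ⊗ R is some a ⊗ 1. If a ⊗ f(1) = 0, applying 1 ⊗ h gives a ⊗ ι(1) = 0, so [a]
   is torsion. *)
apply: raddf_inj => t; have [g _ tensK] := tensor_unit_bij A.
rewrite -[t]tensK; move: (g t) => a; rewrite tensor_mapE => fa0.
have aP : a \in torsion_pred E A.
  by rewrite torsionE -hf -(tensor_mapE h) fa0 raddf0.
have /(congr1 val) /= -> := s0 A (Torsion aP).
exact: raddf0.
Qed.

Theorem corollary2p33 (R : pzRingType)
    (E : injective_envelope (R^o : lmodType R)) :
  splits (torsion_incl E) (torsion_proj E) ->
  (forall (A : rmodType R) (x : torsion E A), x = 0) /\ left_absolutely_pure R.
Proof.
case=> r [t rP].
have s0 : forall (A : rmodType R) (x : torsion E A), x = 0.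
  by apply: (@torsion_eq0_of_retraction _ _ r) => A x; have [] := rP A.
by split=> //; apply: left_absolutely_pure_of_torsion_eq0 s0.
Qed.
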